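(* Let $(X,\tau,\mathbf{S})$ be a Hausdorff locally convex topological vector space whose topology $\tau$ is generated by the family of seminorms $\mathbf{S}$, and let $\mathbf{Q}$ be the corresponding saturated family of seminorms. Let $Y\subseteq X$ be a nonempty compact set and $S:Y\rightrightarrows Y$ be a lower semicontinuous set-valued map such that $S(x)\neq\emptyset$ for all $x\in Y$. If for all $S$-orbits $\{x_i\}_{i=1}^\infty$ one has $$\sum_{i=1}^\infty q(x_{i+1}-x_i)<\infty\quad\text{for all } q\in\mathbf{Q},$$ then there exists a point $\bar{x}\in Y$ such that $S(\bar{x})=\{\bar{x}\}$.
   Context: $X$ is a vector space and $\mathbf{S}$ is a family of seminorms on $X$ that separates points (for each $x\in X\setminus\{0\}$ there is $s\in\mathbf{S}$ with $s(x)>0$); $\tau$ is the locally convex topology generated by $\mathbf{S}$. The saturated family $\mathbf{Q}$ consists of the seminorms $q_{\mathbf{E}}(x):=\max_{s\in\mathbf{E}}s(x)$ for all (nonempty) finite $\mathbf{E}\subseteq\mathbf{S}$. $Y$ carries the subspace topology. A set-valued map $S:Y\rightrightarrows Y$ assigns to each $x\in Y$ a subset $S(x)\subseteq Y$. An $S$-orbit is here a sequence $\{x_i\}_{i=1}^\infty$ in $Y$ with $x_{i+1}\in S(x_i)$ for all $i\ge1$. $S$ is lower semicontinuous if for every $x\in Y$ and every open $V\subseteq Y$ with $S(x)\cap V\neq\emptyset$ there is an open neighborhood $U\subseteq Y$ of $x$ such that $S(x')\cap V\ne\emptyset$ for all $x'\in U$. *)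

(* Defs.v *)
From HB Require Import structures.
From mathcomp Require Import all_boot all_order all_algebra.
From mathcomp Require Import all_classical all_reals all_analysis.

Set Implicit Arguments.
Unset Strict Implicit.
Unset Printing Implicit Defensive.

Import Order.TTheory GRing.Theory Num.Theory.
Import numFieldTopology.Exports numFieldNormedType.Exports.

Local Open Scope classical_set_scope.
Local Open Scope ring_scope.

Section Seminorms.
Context {R : realType}.

Definition is_seminorm (X : lmodType R) (s : X -> R) : Prop :=
  [/\ forall x, 0 <= s x,
      forall x y, s (x + y) <= s x + s y
    & forall (a : R) x, s (a *: x) = `|a| * s x].

Definition separates_points (X : lmodType R) (SS : set (X -> R)) : Prop :=
  forall x : X, x != 0 -> exists2 s, SS s & 0 < s x.

(* [E] may be empty, so that the empty family generates the trivial topology. *)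
Definition topology_generated_by (X : tvsType R) (SS : set (X -> R)) : Prop :=
  forall (x : X) (U : set X), nbhs x U <->
    exists E : set (X -> R), [/\ finite_set E, E `<=` SS &
      exists2 e : R, 0 < e & [set y | forall s, E s -> s (y - x) < e] `<=` U].

(* Seminorms being nonnegative, the default value 0 does not affect the
   maximum over a nonempty [E]. *)
Definition max_seminorm (X : lmodType R) (E : set (X -> R)) (x : X) : R :=
  \big[Num.max/0]_(s \in E) s x.

Definition saturated_family (X : lmodType R) (SS : set (X -> R)) :
    set (X -> R) :=
  [set max_seminorm E | E in
    [set E | [/\ finite_set E, E !=set0 & E `<=` SS]]].

End Seminorms.

Definition set_valued_lsc (T U : topologicalType) (F : T -> set U) : Prop :=
  forall (x : T) (V : set U), open V -> F x `&` V !=set0 ->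
    exists W : set T, [/\ open W, W x & forall x', W x' -> F x' `&` V !=set0].

Definition is_orbit (T : Type) (F : T -> set T) (u : nat -> T) : Prop :=
  forall i, F (u i) (u i.+1).

(* Main.v *)
Require Import Defs.
From HB Require Import structures.
From mathcomp Require Import all_boot all_order all_algebra.
From mathcomp Require Import all_classical all_reals all_analysis.
From mathcomp Require Import finmap lra.

Set Implicit Arguments.
Unset Strict Implicit.
Unset Printing Implicit Defensive.

Import Order.TTheory GRing.Theory Num.Theory.
Import numFieldTopology.Exports numFieldNormedType.Exports.

Local Open Scope classical_set_scope.
Local Open Scope ring_scope.

(** If every point [x] had a successor [y != x] in [F x], then lower
    semicontinuity and compactness would provide finitely many seminorms and a
    single [e > 0] such that each [x] has a successor [y] at distance more than
    [e] from [x] for one of these seminorms. An orbit made of such successors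
    has infinite length for the maximum of these seminorms. *)

Lemma seminorm_distC (R : realType) (X : lmodType R) (s : X -> R) :
  is_seminorm s -> forall x y, s (x - y) = s (y - x).
Proof.
by case=> _ _ sZ x y; rewrite -(opprB y x) -(scaleN1r (y - x)) sZ normrN1 mul1r.
Qed.

Lemma nbhs_seminorm_ball (R : realType) (X : tvsType R) (SS : set (X -> R))
    (s : X -> R) (x : X) (e : R) :
  topology_generated_by SS -> SS s -> 0 < e ->
  nbhs x [set y | s (y - x) < e].
Proof.
move=> gen Ss e0; apply/gen; exists [set s]; split => //; first by move=> _ ->.
by exists e => // y; apply.
Qed.

Lemma max_seminorm_ge0 (R : realType) (X : lmodType R) (E : set (X -> R)) x :
  0 <= max_seminorm E x.
Proof. exact: bigmax_ge_id. Qed.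

Lemma le_max_seminorm (R : realType) (X : lmodType R) (E : set (X -> R)) s x :
  finite_set E -> E s -> s x <= max_seminorm E x.
Proof.
(* A big operator over a finite set runs only over indices whose value differs from the neutral
   element, here 0, so the case [s x = 0] is separate. *)
move=> finE Es; have [->|sx0] := eqVneq (s x) 0; first exact: max_seminorm_ge0.
rewrite /max_seminorm.
apply: (@Order.TotalTheory.le_bigmax_seq _ _ _ _ _ s xpredT (fun t => t x)) => //.
rewrite in_finite_support; last exact: finite_setIl.
by apply/mem_set; split => //=; apply/eqP.
Qed.

Lemma nneseries_ge_cst_pinfty (R : realType) (a : nat -> R) (e : R) :
  0 < e -> (forall i, e <= a i) ->
  (\sum_(0 <= i <oo) (a i)%:E = +oo)%E.
Proof.
move=> e0 ea; apply/eqyP => A A0.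
have a0 n : (0 <= n)%N -> true -> (0 <= (a n)%:E)%E.
  by move=> _ _; rewrite lee_fin (le_trans _ (ea n))// ltW.
(* This makes [A < n * e], so the first [n] terms already exceed [A]. *)
pose n := (Num.trunc (A / e)).+1.
apply: le_trans (nneseries_lim_ge n a0).
apply: (@le_trans _ _ (\sum_(0 <= i < n) e%:E)%E).
  rewrite sumEFin lee_fin sumr_const_nat subn0 -[leRHS]mulr_natr mulrC.
  by rewrite -ler_pdivrMr// ltW// truncnS_gt.
by apply: lee_sum => i _; rewrite lee_fin.
Qed.

(** Near [x], lower semicontinuity keeps a successor [y'] of [x'] close to [y]. If both endpoints
    move by less than a quarter of [s (y - x)], the triangle inequality leaves more than half of
    it. *)
Lemma lsc_far_successor (R : realType) (X : tvsType R) (SS : set (X -> R))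
    (Y : set X) (F : Y -> set Y) (s : X -> R) (x y : Y) :
  topology_generated_by SS -> SS s -> is_seminorm s -> set_valued_lsc F ->
  F x y -> 0 < s (\val y - \val x) ->
  exists W : set X, [/\ open W, W (\val x) &
    forall x' : Y, W (\val x') ->
      exists2 y', F x' y' & s (\val y - \val x) / 2 < s (\val y' - \val x')].
Proof.
set a := s _ => gen Ss sems lscF Fxy a0.
have a40 : 0 < a / 4 by lra.
pose B (z : X) := interior [set w | s (w - z) < a / 4].
have oB z : open (B z) by exact: open_interior.
have Bz z : B z z by exact: nbhs_seminorm_ball.
have [||U [oU Ux UF]] := lscF x (set_val @^-1` B (\val y)).
- by exists (B (\val y)).
- by exists y; split => //; exact: Bz.
case: oU Ux UF => A oA <- Ax UF.
exists (A `&` B (\val x)); split; [exact: openI|by split|].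
move=> x' [Ax' /interior_subset/= Bx'].
have [y' [Fy' /interior_subset/= By']] := UF x' Ax'.
exists y' => //.
case: (sems) => _ sD _.
have := sD (\val y - \val y') ((\val y' - \val x') + (\val x' - \val x)).
have := sD (\val y' - \val x') (\val x' - \val x).
rewrite (seminorm_distC sems (\val y)).
have -> : (\val y - \val y') + ((\val y' - \val x') + (\val x' - \val x)) =
  \val y - \val x by rewrite [X in _ + X]addrA subrK addrA subrK.
rewrite -/a; move: Bx' By' => /=; rewrite /set_val/=; lra.
Qed.

Theorem corollary3p3 (R : realType) (X : tvsType R) (SS : set (X -> R))
    (Y : set X) (F : Y -> set Y) :
  hausdorff_space X ->
  (forall s, SS s -> is_seminorm s) ->
  separates_points SS ->
  topology_generated_by SS ->
  Y !=set0 ->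
  compact Y ->
  set_valued_lsc F ->
  (forall x : Y, F x !=set0) ->
  (forall u : nat -> Y, is_orbit F u ->
    forall q, saturated_family SS q ->
      (\sum_(0 <= i <oo) (q (\val (u i.+1) - \val (u i)))%:E < +oo)%E) ->
  exists x : Y, F x = [set x].
Proof.
move=> _ sems sep gen [x0 Yx0] cptY lscF F0 sumF; apply: contrapT => nofix.
(* The triple packs a seminorm, a distance and an open neighborhood on which both work uniformly. *)
have far (x : Y) : exists p : (X -> R) * R * set X,
    [/\ SS p.1.1, 0 < p.1.2, open p.2, p.2 (\val x) &
      forall x' : Y, p.2 (\val x') ->
        exists2 y, F x' y & p.1.2 < p.1.1 (\val y - \val x')].
  have [y Fxy yx] : exists2 y, F x y & y != x.
    apply: contrapT => nox; apply: nofix; exists x.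
    have Fx y : F x y -> y = x.
      by move=> Fxy; apply: contrapT => /eqP yx; apply: nox; exists y.
    apply/seteqP; split => [y /Fx//|_ ->].
    by have [y Fy] := F0 x; rewrite -{2}(Fx y Fy).
  have [s Ss syx] : exists2 s, SS s & 0 < s (\val y - \val x).
    by apply: sep; rewrite subr_eq0 (inj_eq val_inj).
  have [W [oW Wx WF]] := lsc_far_successor gen Ss (sems s Ss) lscF Fxy syx.
  by exists (s, s (\val y - \val x) / 2, W); split => //=; rewrite divr_gt0.
have [p pP] := choice far.
(* [compact_cover] is stated for pointed spaces only. *)
pose Xp := HB.pack_for ptopologicalType X (isPointed.Build X 0).
have [D _ DY] : finite_subset_cover setT (fun x => (p x).2) Y.
  have := cptY; rewrite (@compact_cover Xp); apply.
    by move=> x _; case: (pP x).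
  move=> x Yx; exists (SigSub (mem_set Yx)) => //.
  by case: (pP (SigSub (mem_set Yx))).
pose E := [set (p x).1.1 | x in [set` D]].
have finE : finite_set E by exact: finite_image.
pose q := max_seminorm E.
(* The default 1 keeps the minimum positive and can only lower it, so [e] still bounds every chosen
   distance from below. *)
pose e := \big[Num.min/1]_(x <- D) (p x).1.2.
have e0 : 0 < e.
  apply: (big_ind (fun z : R => 0 < z)); first exact: ltr01.
    by move=> a b a0 b0; rewrite lt_min a0.
  by move=> x _; case: (pP x).
have step (x : Y) : exists y, F x y /\ e <= q (\val y - \val x).
  have [z zD zx] := DY (\val x) (set_valP x).
  have [_ _ _ _ /(_ x zx) [y Fxy lty]] := pP z.
  exists y; split => //; apply: (@le_trans _ _ (p z).1.2).
    exact: Order.TotalTheory.ge_bigmin_seq.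
  by apply: le_trans (ltW lty) _; apply: le_max_seminorm => //; exists z.
have [g gP] := choice step.
pose x1 : Y := SigSub (mem_set Yx0).
have qS : saturated_family SS q.
  (* [E] is nonempty because some member of the cover contains [x0]. *)
  exists E => //; split => //.
    by have [z zD _] := DY x0 Yx0; exists (p z).1.1, z.
  by move=> _ [z _ <-]; case: (pP z).
have := sumF (fun n => iter n g x1) (fun i => (gP _).1) q qS.
rewrite (@nneseries_ge_cst_pinfty _ (fun i => q _) e) ?ltxx// => i.
exact: (gP _).2.
Qed.
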